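(* Let $G$ be a graph with at least one edge. Then (a) $Epa(G) \geq 2$, and (b) $epa(G) = 1$ if and only if the set of all $\gamma$-bad vertices of $G$ is neither empty nor independent.
   Context: Graphs are finite and simple. $\gamma(H)$ denotes the domination number of a graph $H$; a $\gamma$-set of $H$ is a dominating set of $H$ of cardinality $\gamma(H)$. A vertex of $H$ is $\gamma$-bad if it belongs to no $\gamma$-set of $H$. For distinct vertices $u,v$ of $G$ and an integer $k\geq 0$, $G_{u,v,k}$ denotes the graph obtained from the disjoint union of $G$ and a path $x_0,x_1,\dots,x_{k+1}$ by identifying $u$ with $x_0$ and $v$ with $x_{k+1}$ (so $k$ new vertices are added; the edge $uv$ of $G$, if present, is kept; when $k=0$ and $uv\in E(G)$ this is just $G$, up to a parallel edge). $pa(u,v)$ is the minimum integer $k\geq 0$ such that $\gamma(G) < \gamma(G_{u,v,k})$. $epa(G) = \min\{pa(u,v) \mid uv \in E(G)\}$ and $Epa(G) = \max\{pa(u,v) \mid uv \in E(G)\}$. *)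

(* Defs.v *)
From HB Require Import structures.
From mathcomp Require Import all_boot.

Set Implicit Arguments.
Unset Strict Implicit.
Unset Printing Implicit Defensive.

Record sgraph := SGraph {
  vertex :> finType;
  adj : rel vertex;
  adj_sym : symmetric adj;
  adj_irrefl : irreflexive adj
}.

Definition dominating (G : sgraph) (D : {set G}) : bool :=
  [forall v, (v \notin D) ==> [exists d in D, adj d v]].

Definition gamma (G : sgraph) : nat :=
  #|[arg min_(D < [set: G] | dominating D) #|D|]|.

Definition gamma_set (G : sgraph) (D : {set G}) : bool :=
  dominating D && (#|D| == gamma G).

Definition gamma_bad (G : sgraph) : {set G} :=
  [set v | ~~ [exists D : {set G}, gamma_set D && (v \in D)]].

Definition independent (G : sgraph) (A : {set G}) : bool :=
  [forall x in A, forall y in A, ~~ adj x y].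

(* G_{u,v,k} has vertex type G + 'I_k: with x_0 := inl u, x_{k+1} := inl v and
   x_{i+1} := inr i for i : 'I_k, the adjacency is that of G together with the
   pairs x_i x_{i+1}.  The test u != v only keeps the relation irreflexive in
   the degenerate case u = v, k = 0. *)
Definition add_path_rel (G : sgraph) (u v : G) (k : nat) : rel (G + 'I_k) :=
  fun a b => match a, b with
  | inl a, inl b =>
      adj a b || [&& k == 0, u != v & ((a, b) == (u, v)) || ((a, b) == (v, u))]
  | inl a, inr i | inr i, inl a =>
      ((a == u) && (i == 0 :> nat)) || ((a == v) && (i.+1 == k))
  | inr i, inr j => (i.+1 == j) || (j.+1 == i)
  end.

Lemma add_path_sym (G : sgraph) (u v : G) k : symmetric (add_path_rel u v (k:=k)).
Proof.
move=> [a|i] [b|j] //=; last by rewrite orbC.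
by rewrite adj_sym !xpair_eqE orbC [X in _ = _ || [&& _, _ & X]]orbC
  ![(b == _) && _]andbC orbC.
Qed.

Lemma add_path_irrefl (G : sgraph) (u v : G) k :
  irreflexive (add_path_rel u v (k:=k)).
Proof.
move=> [a|i] /=; last by rewrite orbb gtn_eqF.
rewrite adj_irrefl !xpair_eqE /=; case: (eqVneq u v); rewrite ?andbF //= => uv.
by case: (eqVneq a u) => [->|_]; rewrite ?(negPf uv) ?andbF.
Qed.

Definition add_path (G : sgraph) (u v : G) (k : nat) : sgraph :=
  SGraph (@add_path_sym G u v k) (@add_path_irrefl G u v k).

Lemma gammaP (G : sgraph) : exists2 D : {set G}, dominating D & #|D| = gamma G.
Proof.
rewrite /gamma; case: arg_minnP => [|D domD _]; last by exists D.
by apply/forallP=> v; rewrite inE.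
Qed.

(* A vertex dominates at most 3 of the k added vertices. *)
Lemma gamma_add_path (G : sgraph) (u v : G) k : k <= 3 * gamma (add_path u v k).
Proof.
have [D domD <-] := gammaP (add_path u v k).
pose near (d : add_path u v k) : seq nat :=
  if d is inr i then [:: i.-1; val i; i.+1] else [:: 0; k.-1; 0].
have -> : 3 * #|D| = size (flatten [seq near d | d <- enum D]).
  rewrite size_flatten /shape -map_comp cardE mulnC.
  by elim: (enum D) => //= -[a|i] s ih; rewrite mulSn ih.
rewrite -[leqLHS](size_iota 0); apply: uniq_leq_size (iota_uniq _ _) _ => j.
rewrite mem_iota /= add0n => jk; pose x : add_path u v k := inr (Ordinal jk).
apply/flatten_mapP; have /implyP := forallP domD x; case: (boolP (x \in D)).
  by exists x; rewrite ?mem_enum //= !inE eqxx orbT.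
move=> _ /(_ isT) /existsP[d /andP[dD dx]]; exists d; first by rewrite mem_enum.
case: d dx {dD} => [a|i] /=; rewrite !inE.
  by case/orP=> /andP[_ /eqP]; [move=> -> | move=> <-]; rewrite eqxx ?orbT.
by case/orP=> /eqP <-; rewrite eqxx ?orbT.
Qed.

Lemma pa_exists (G : sgraph) (u v : G) :
  exists k, gamma G < gamma (add_path u v k).
Proof.
exists (3 * gamma G).+1.
by have := gamma_add_path u v (3 * gamma G).+1; rewrite ltn_pmul2l.
Qed.

Definition pa (G : sgraph) (u v : G) : nat := ex_minn (pa_exists u v).

Definition Epa (G : sgraph) : nat :=
  \max_(e : G * G | adj e.1 e.2) pa e.1 e.2.

(* The seed Epa G of the minimum bounds every term, so it is irrelevant as soon
   as G has an edge. *)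
Definition epa (G : sgraph) : nat :=
  \big[minn/Epa G]_(e : G * G | adj e.1 e.2) pa e.1 e.2.

(* Main.v *)
Require Import Defs.
From mathcomp Require Import all_boot.

(** For an edge [uv], adding the path [u - x - v] leaves the
    domination number unchanged exactly when some minimum dominating set of [G]
    meets [{u, v}]: such a set already dominates [x], and conversely the
    retraction sending [x] to [u] turns any dominating set of the larger graph
    into a dominating set of [G] that is no larger and meets [{u, v}].
    Hence [pa u v >= 1] on edges, with equality iff both ends are bad. For the
    bound on [Epa], a minimum dominating set always contains an end of some
    edge. *)

Lemma dominatingP {G : sgraph} {D : {set G}} :
  reflect (forall v, v \notin D -> exists2 d, d \in D & adj d v)
          (dominating D).
Proof.
apply: (iffP forallP) => [domD v vD | domD v].
  by have /exists_inP := implyP (domD v) vD.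
by apply/implyP => /domD ?; apply/exists_inP.
Qed.

Lemma gamma_min {G : sgraph} (D : {set G}) : dominating D -> gamma G <= #|D|.
Proof.
rewrite /gamma; case: arg_minnP => [|E _ minE]; last exact: minE.
by apply/dominatingP => v; rewrite inE.
Qed.

Lemma gamma_goodP {G : sgraph} {v : G} :
  reflect (exists2 D : {set G}, gamma_set D & v \in D) (v \notin gamma_bad G).
Proof. by rewrite inE negbK; apply: exists_inP. Qed.

(** With no new vertices, edges can only be gained, so a minimum dominating set of [G] stays
    dominating. This excludes the value 0 for [pa]. *)
Lemma gamma_add_path0 {G : sgraph} (u v : G) :
  gamma (add_path u v 0) <= gamma G.
Proof.
have [D /dominatingP domD <-] := gammaP G.
rewrite -(card_imset (mem D) (inl_inj (B := 'I_0))).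
apply: gamma_min; apply/dominatingP => -[w | [//]].
rewrite mem_imset; last exact: inl_inj.
by move=> /domD[d dD dw]; exists (inl d); rewrite ?imset_f //= dw.
Qed.

Lemma gamma_add_path1 {G : sgraph} (u v : G) : adj u v ->
  (gamma G < gamma (add_path u v 1)) = (u \in gamma_bad G) && (v \in gamma_bad G).
Proof.
move=> uv; apply/idP/idP; apply: contraLR; rewrite -leqNgt.
  move=> bad; have {bad} [D /andP[/dominatingP domD /eqP <-] Duv] :
      exists2 D : {set G}, gamma_set D & (u \in D) || (v \in D).
    move: bad; rewrite negb_and => /orP[] /gamma_goodP[D gD inD];
    by exists D => //; rewrite inD ?orbT.
  rewrite -(card_imset (mem D) (inl_inj (B := 'I_1))).
  apply: gamma_min; apply/dominatingP => -[w | i _].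
    rewrite mem_imset; last exact: inl_inj.
    by move=> /domD[d dD dw]; exists (inl d); rewrite ?imset_f //= dw.
  by case/orP: Duv => aD; [exists (inl u) | exists (inl v)];
    rewrite ?imset_f //= (ord1 i) !eqxx ?orbT.
have [D /dominatingP domD <-] := gammaP (add_path u v 1) => Dle.
pose r (a : add_path u v 1) : G := if a is inl b then b else u.
have rD w : inl w \in D -> w \in r @: D by exact: (imset_f r).
have rDu i : inr i \in D -> u \in r @: D by exact: (imset_f r).
have Duv : (u \in r @: D) || (v \in r @: D).
  (* The new vertex either lies in [D], and retracts to [u], or is dominated by one of its
     neighbours [u], [v]. *)
  case: (boolP (inr ord0 \in D)) => [/rDu -> // | /domD[[a | i] aD //=]].
    by move=> /orP[] /andP[/eqP <- _]; rewrite (rD a) ?orbT.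
  by rewrite (rDu _ aD).
have domr : dominating (r @: D).
  apply/dominatingP => w wD.
  have /domD[[a | i] aD /=] := contra (rD w) wD.
    by rewrite orbF => aw; exists a; first exact: rD.
  (* Here the new vertex dominated [w], so [w] is [u] or [v]. The image contains [u], which leaves
     [w = v], dominated by [u] through the edge [uv]. *)
  case/orP => /andP[/eqP wE _]; subst w; last by exists u; first exact: rDu aD.
  by rewrite (rDu _ aD) in wD.
have gr : gamma_set (r @: D).
  by rewrite /gamma_set domr eqn_leq gamma_min // (leq_trans (leq_imset_card _ _)).
rewrite negb_and.
by case/orP: Duv => inD; apply/orP; [left | right]; apply/gamma_goodP; exists (r @: D).
Qed.

Lemma pa_gt0 (G : sgraph) (u v : G) : 0 < pa u v.
Proof.
rewrite /pa; case: ex_minnP => -[|//].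
by rewrite ltnNge gamma_add_path0.
Qed.

(** Since [pa] is a least index and is positive, it is 1 exactly when a single new vertex already
    raises [gamma]. *)
Lemma pa_eq1 {G : sgraph} (u v : G) : adj u v ->
  (pa u v == 1) = (u \in gamma_bad G) && (v \in gamma_bad G).
Proof.
move=> uv; rewrite -gamma_add_path1 // eqn_leq pa_gt0 andbT.
have := pa_gt0 _ u v; rewrite /pa; case: ex_minnP => m ltm minm m_gt0.
apply/idP/idP => [m_le1 | /minm //].
by have <- : m = 1 by apply/eqP; rewrite eqn_leq m_le1.
Qed.

Lemma exists_good_edge {G : sgraph} : (exists u v : G, adj u v) ->
  exists u v : G, adj u v /\ u \notin gamma_bad G.
Proof.
case=> u [v uv]; have [D domD /eqP cardD] := gammaP G.
have gD : gamma_set D by rewrite /gamma_set domD.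
(* If [u] is outside [D], the edge to its dominator [d] replaces [uv]. *)
case: (boolP (u \in D)) => [uD | /(dominatingP domD)[d dD du]].
  by exists u, v; split => //; apply/gamma_goodP; exists D.
by exists d, u; split => //; apply/gamma_goodP; exists D.
Qed.

Lemma Epa_ge2 {G : sgraph} : (exists u v : G, adj u v) -> 2 <= Epa G.
Proof.
case/exists_good_edge=> u [v [uv ugood]].
apply: leq_trans (leq_bigmax_cond (u, v) uv).
by rewrite ltn_neqAle pa_gt0 eq_sym pa_eq1 // (negPf ugood).
Qed.

Lemma epa_le {G : sgraph} (u v : G) : adj u v -> epa G <= pa u v.
Proof.
move=> uv; have := mem_index_enum (u, v); rewrite /epa.
(* The bound appears at the position of [(u, v)] in the enumeration and survives every further
   [minn]. *)
elim: (index_enum _) => //= e r IHr; rewrite inE big_cons.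
case/predU1P => [<- | /IHr le_r]; first by rewrite /= uv geq_minl.
by case: ifP => // _; rewrite geq_min le_r orbT.
Qed.

(** An iterated [minn] returns its seed or one of its terms; the seed is excluded or bounded
    separately in [epa_eq1]. *)
Lemma epa_attained (G : sgraph) :
  epa G = Epa G \/ exists2 e : G * G, adj e.1 e.2 & epa G = pa e.1 e.2.
Proof.
rewrite /epa; elim/big_ind: _ => [|x y IHx IHy|e he]; first by left.
  by rewrite /minn; case: ifP.
by right; exists e.
Qed.

Lemma epa_eq1 {G : sgraph} : (exists u v : G, adj u v) ->
  epa G = 1 <-> exists u v : G, adj u v /\ pa u v = 1.
Proof.
move=> hE; have Epa2 := Epa_ge2 hE; split=> [epa1 | [u [v [uv pa1]]]].
  case: (epa_attained G) => [epaE | [[u v] uv epaE]].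
    (* The value 1 cannot come from the seed, which is at least 2. *)
    by rewrite -epaE epa1 in Epa2.
  by exists u, v; rewrite -epaE.
apply/eqP; rewrite eqn_leq -{1}pa1 epa_le //=.
by case: (epa_attained G) => [-> | [e _ ->]]; [exact: ltnW | exact: pa_gt0].
Qed.

Lemma not_independentP {G : sgraph} {A : {set G}} :
  reflect (exists u v, adj u v /\ (u \in A) && (v \in A)) (~~ independent A).
Proof.
apply: (iffP idP) => [|[u [v [uv /andP[uA vA]]]]].
  case/forall_inPn => u uA /forall_inPn[v vA]; rewrite negbK => uv.
  by exists u, v; rewrite uA.
by apply/forall_inPn; exists u => //; apply/forall_inPn; exists v; rewrite ?negbK.
Qed.

Theorem corollary3 (G : sgraph) (hE : exists u v : G, adj u v) :
  2 <= Epa G /\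
  (epa G = 1 <-> gamma_bad G != set0 /\ ~~ independent (gamma_bad G)).
Proof.
split; first exact: Epa_ge2.
split=> [/(epa_eq1 hE)[u [v [uv /eqP]]] | [_ /not_independentP[u [v [uv bad]]]]].
  (* An edge with [pa] equal to 1 has two bad ends: the pair refutes independence, and [u] alone
     shows nonemptiness. *)
  rewrite pa_eq1 // => bad; split; last by apply/not_independentP; exists u, v.
  by apply/set0Pn; exists u; case/andP: bad.
by apply/epa_eq1 => //; exists u, v; split => //; apply/eqP; rewrite pa_eq1.
Qed.
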